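(* Let $P$ be any $k\times l$ pattern with no empty columns, and let $m_0$ be a fixed positive integer. If $\operatorname{sat}(m_0,n,P)=O(1)$ (as $n\to\infty$), then there is a horizontal witness for $P$ with at most $(l-1)m_0+1$ columns, and $\operatorname{sat}(m_0,n,P)\le (l-1)m_0^2$.
   Context: All matrices are 0-1 matrices; a pattern is a 0-1 matrix. A row or column is empty if it contains no ones. A matrix $M$ contains $P$ if some submatrix of $M$ (obtained by deleting rows and columns) can be turned into $P$ by changing some number (possibly zero) of its ones to zeroes; otherwise $M$ avoids $P$. The weight of a matrix is its number of $1$ entries. $M$ is $P$-saturated if $M$ does not contain $P$, but changing any $0$ entry of $M$ to a $1$ yields a matrix containing $P$. $\operatorname{sat}(m,n,P)$ is the minimum weight of an $m\times n$ $P$-saturated matrix. A column of a matrix $W$ is expandable with respect to $P$ if it is empty and changing any single entry of it to a $1$ introduces a copy of $P$. For a pattern $P$ with no empty columns, a horizontal witness for $P$ is a matrix which does not contain $P$ and which has an expandable column. *)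

(* Defs.v *)
From mathcomp Require Import all_boot all_order all_algebra.

Set Implicit Arguments.
Unset Strict Implicit.
Unset Printing Implicit Defensive.

Section Patterns.

Definition increasing (k m : nat) (f : {ffun 'I_k -> 'I_m}) : bool :=
  [forall a : 'I_k, forall b : 'I_k, (a < b) ==> (f a < f b)].

(* The strictly increasing maps f and g select the rows and columns kept. *)
Definition contains (m n k l : nat)
    (M : 'M[bool]_(m, n)) (P : 'M[bool]_(k, l)) : bool :=
  [exists f : {ffun 'I_k -> 'I_m}, exists g : {ffun 'I_l -> 'I_n},
    [&& increasing f, increasing g
      & [forall i, forall j, P i j ==> mxsub f g M i j]]].

Definition weight (m n : nat) (M : 'M[bool]_(m, n)) : nat :=
  #|[set ij : 'I_m * 'I_n | M ij.1 ij.2]|.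

Definition set_one (m n : nat) (M : 'M[bool]_(m, n)) (i : 'I_m) (j : 'I_n) :
    'M[bool]_(m, n) :=
  \matrix_(a, b) (((a == i) && (b == j)) || M a b).

Definition saturated (m n k l : nat)
    (P : 'M[bool]_(k, l)) (M : 'M[bool]_(m, n)) : bool :=
  ~~ contains M P &&
  [forall i, forall j, ~~ M i j ==> contains (set_one M i j) P].

(* The default value m * n bounds every weight, so it does not affect the
   minimum as soon as a saturated matrix exists; see satP. *)
Definition sat (m n k l : nat) (P : 'M[bool]_(k, l)) : nat :=
  \big[minn/(m * n)%N]_(M : 'M[bool]_(m, n) | saturated P M) weight M.

Definition empty_col (m n : nat) (M : 'M[bool]_(m, n)) (j : 'I_n) : bool :=
  [forall i, ~~ M i j].

Definition expandable (m n k l : nat)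
    (P : 'M[bool]_(k, l)) (W : 'M[bool]_(m, n)) (j : 'I_n) : bool :=
  empty_col W j && [forall i, contains (set_one W i j) P].

Definition horizontal_witness (m n k l : nat)
    (P : 'M[bool]_(k, l)) (W : 'M[bool]_(m, n)) : bool :=
  ~~ contains W P && [exists j, expandable P W j].

Lemma weight_le (m n : nat) (M : 'M[bool]_(m, n)) : weight M <= m * n.
Proof.
by apply: leq_trans (max_card _) _; rewrite card_prod !card_ord.
Qed.

Lemma weight_set_one (m n : nat) (M : 'M[bool]_(m, n)) i j :
  ~~ M i j -> weight M < weight (set_one M i j).
Proof.
move=> Mij; apply: proper_card; apply/properP; split.
  by apply/subsetP => -[a b]; rewrite !inE mxE /= => ->; rewrite orbT.
by exists (i, j); rewrite !inE /= ?mxE ?eqxx.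
Qed.

Lemma saturated_exists (m n k l : nat) (P : 'M[bool]_(k, l)) :
  (exists i j, P i j) -> exists M : 'M[bool]_(m, n), saturated P M.
Proof.
move=> [i0 [j0 Pij]].
have av0 : ~~ contains (const_mx false : 'M[bool]_(m, n)) P.
  apply/existsP => -[f /existsP[g /and3P[_ _ /forallP/(_ i0)/forallP/(_ j0)]]].
  by rewrite Pij !mxE.
have [M /= avM maxM] :=
  @arg_maxnP _ _ (fun M : 'M[bool]_(m, n) => ~~ contains M P) (@weight m n) av0.
exists M; rewrite /saturated avM /=.
apply/forallP => i; apply/forallP => j; apply/implyP => Mij.
apply: contraT => /maxM; rewrite /= leqNgt.
by rewrite weight_set_one.
Qed.

Lemma satP (m n k l : nat) (P : 'M[bool]_(k, l)) :
  (exists i j, P i j) ->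
  (exists2 M : 'M[bool]_(m, n), saturated P M & weight M = sat m n P) /\
  (forall M : 'M[bool]_(m, n), saturated P M -> sat m n P <= weight M).
Proof.
move=> /(saturated_exists m n)[M0 satM0].
have lb (M : 'M[bool]_(m, n)) : saturated P M -> sat m n P <= weight M.
  move=> satM; rewrite /sat; have := mem_index_enum M.
  elim: (index_enum _) => // N s IHs; rewrite inE big_cons.
  case/predU1P=> [<-|/IHs le_s]; first by rewrite satM geq_minl.
  by case: ifP => // _; rewrite geq_min le_s orbT.
split=> //.
have [M /= satM minM] := @arg_minnP _ _ (saturated P) (@weight m n) satM0.
exists M => //; apply/eqP; rewrite eqn_leq lb // andbT.
rewrite /sat; elim/big_ind: _ => [|x y lx ly|N /minM //]; first exact: weight_le.
by rewrite leq_min lx ly.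
Qed.

End Patterns.

(* Main.v *)
Require Import Defs.
From mathcomp Require Import all_boot all_order all_algebra.
From mathcomp Require Import zify.

Set Implicit Arguments.
Unset Strict Implicit.
Unset Printing Implicit Defensive.

(** Once n exceeds a bound C on the saturation numbers, a P-saturated matrix M
    with m0 rows, n columns and weight at most C has an empty column j, and
    saturation makes j expandable.  For each of the m0 rows i, the copy of P
    created by a one at (i, j) uses j and l - 1 further columns; so j is still
    expandable in the submatrix of M on a set S of at most (l - 1) * m0 + 1
    columns.  This submatrix is the witness.

    For the bound on sat m0 n P with n >= #|S|, replace j in that submatrix by
    n - #|S| + 1 adjacent copies of itself.  The result still avoids P, because
    a copy of P has no empty column and hence cannot touch the copies of j; and
    each copy of j is expandable.  Now add ones as long as P is avoided.  None
    can ever go into a copy of j, so the saturated matrix obtained has its ones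
    in #|S| - 1 <= (l - 1) * m0 columns.  When n < #|S|, the total number of
    entries is already small enough.

    Both matrices have the form colsub h M, for a weakly increasing map h of
    column indices onto S that is injective away from j (stretch_columns): the
    witness is the case n = #|S|.  Avoidance and expandability are therefore
    proved once, in avoids_stretch and expandable_stretch. *)

Lemma containsP (m n k l : nat) (M : 'M[bool]_(m, n)) (P : 'M[bool]_(k, l)) :
  reflect (exists (f : 'I_k -> 'I_m) (g : 'I_l -> 'I_n),
             [/\ {homo f : a b / a < b}, {homo g : a b / a < b}
               & forall i j, P i j -> M (f i) (g j)])
          (contains M P).
Proof.
apply: (iffP existsP) => [[f /existsP[g /and3P[incf incg PM]]]|[f [g [incf incg PM]]]].
  exists f, g; split=> [a b|a b|i j Pij].
  - by move/forallP: incf => /(_ a)/forallP/(_ b)/implyP; apply.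
  - by move/forallP: incg => /(_ a)/forallP/(_ b)/implyP; apply.
  - by move/forallP: PM => /(_ i)/forallP/(_ j)/implyP/(_ Pij); rewrite mxE.
exists (finfun f); apply/existsP; exists (finfun g); apply/and3P; split.
- by apply/forallP => a; apply/forallP => b; apply/implyP; rewrite !ffunE; apply: incf.
- by apply/forallP => a; apply/forallP => b; apply/implyP; rewrite !ffunE; apply: incg.
- by apply/forallP => i; apply/forallP => j; apply/implyP => /PM; rewrite mxE !ffunE.
Qed.

Lemma contains_mono (m n k l : nat) (M M' : 'M[bool]_(m, n)) (P : 'M[bool]_(k, l)) :
  (forall i j, M i j -> M' i j) -> contains M P -> contains M' P.
Proof.
move=> leM /containsP[f [g [incf incg PM]]]; apply/containsP; exists f, g.
by split=> // i j /PM /leM.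
Qed.

Lemma set_oneE (m n : nat) (M : 'M[bool]_(m, n)) i j a b :
  set_one M i j a b = ((a == i) && (b == j)) || M a b.
Proof. by rewrite mxE. Qed.

(** If no column is empty, choosing a one in each injects the columns into the
    ones. *)
Lemma exists_empty_col (m n : nat) (M : 'M[bool]_(m, n)) :
  weight M < n -> exists j, empty_col M j.
Proof.
move=> wM; apply/existsP; apply: contraLR wM => /existsPn noE; rewrite -leqNgt.
have /fin_all_exists[r Mr] j : exists i, M i j.
  by have /forallPn[i /negPn Mij] := noE j; exists i.
have inj : injective (fun j => (r j, j)) by move=> a b [].
rewrite -[leqLHS](card_ord n) -cardsT -(card_imset _ inj); apply: subset_leq_card.
by apply/subsetP => _ /imsetP[j _ ->]; rewrite inE /= Mr.
Qed.

(** Extending an avoiding matrix by as many ones as possible saturates it. *)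
Lemma saturated_above (m n k l : nat) (P : 'M[bool]_(k, l)) (W : 'M[bool]_(m, n)) :
  ~~ contains W P ->
  exists2 M : 'M[bool]_(m, n), saturated P M & forall i j, W i j -> M i j.
Proof.
move=> avW.
pose above (M : 'M[bool]_(m, n)) :=
  ~~ contains M P && [forall i, forall j, W i j ==> M i j].
have aboveW : above W.
  by rewrite /above avW; apply/forallP => i; apply/forallP => j; apply/implyP.
have [M /andP[avM WM] maxM] := @arg_maxnP _ _ above (@weight m n) aboveW.
have leWM i j : W i j -> M i j by apply/implyP; move/forallP: WM => /(_ i)/forallP/(_ j).
exists M => //; rewrite /saturated avM.
apply/forallP => i; apply/forallP => j; apply/implyP => Mij.
apply: contraT => avM'; have /maxM : above (set_one M i j).
  rewrite /above avM'; apply/forallP => a; apply/forallP => b; apply/implyP => /leWM.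
  by rewrite set_oneE => ->; rewrite orbT.
by rewrite /= leqNgt weight_set_one.
Qed.

Lemma sorted_enum_ord (N : nat) (S : {set 'I_N}) :
  sorted ltn [seq val x | x <- enum S].
Proof.
rewrite sorted_map {1}/enum_mem -enumT; apply: sorted_filter => [a b c|].
  exact: ltn_trans.
by rewrite -sorted_map val_enum_ord iota_ltn_sorted.
Qed.

(** Listing S in increasing order with j repeated n - #|S| + 1 times gives h.
    Each occurrence b of j yields a strictly increasing section s of h that
    passes through b; copies of a pattern are lifted along s. *)
Lemma stretch_columns (N n : nat) (S : {set 'I_N}) (j : 'I_N) :
  j \in S -> #|S| <= n ->
  exists h : 'I_n -> 'I_N,
    [/\ forall b, h b \in S,
        {homo h : a b / a <= b},
        forall a b : 'I_n, a < b -> h a = h b -> h a = j,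
        exists b, h b = j
      & forall b, h b = j -> exists s : 'I_N -> 'I_n,
          [/\ s j = b, {in S, cancel s h} & {in S &, {homo s : x y / x < y}}]].
Proof.
move=> Sj leSn; pose e q := nth j (enum S) q; pose p := index j (enum S).
pose d := n - #|S|.
have sizeS : size (enum S) = #|S| by rewrite -cardE.
have ltp x : x \in S -> index x (enum S) < #|S|.
  by move=> Sx; rewrite -sizeS index_mem mem_enum.
have eK x : x \in S -> e (index x (enum S)) = x.
  by move=> Sx; rewrite /e nth_index // mem_enum.
have lt_e a b : a < b -> b < #|S| -> e a < e b.
  move=> ab bS; have aS := ltn_trans ab bS.
  have := sorted_ltn_nth ltn_trans 0 (sorted_enum_ord S).
  move=> /(_ a b); rewrite !inE size_map sizeS !(nth_map j) ?sizeS //.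
  by apply.
have le_e a b : a <= b -> b < #|S| -> e a <= e b.
  by rewrite leq_eqVlt => /orP[/eqP-> //|ab /(lt_e _ _ ab)/ltnW].
have e_inj a b : a < #|S| -> b < #|S| -> e a = e b -> a = b.
  move=> aS bS eab; case: (ltngtP a b) => // [/lt_e/(_ bS)|/lt_e/(_ aS)];
    by rewrite eab ltnn.
have idx_lt x y : x \in S -> y \in S -> x < y -> index x (enum S) < index y (enum S).
  move=> Sx Sy; rewrite !ltnNge; apply: contra => /le_e/(_ (ltp _ Sx)).
  by rewrite !eK.
have pS := ltp _ Sj; have ep := eK _ Sj; rewrite -/p in pS ep.
(* The position phi b advances to p, waits there for d further steps, and then
   advances again. *)
pose phi b := maxn (minn b p) (b - d).
have phiS (b : 'I_n) : phi b < #|S| by have := ltn_ord b; rewrite /phi /d; lia.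
exists (fun b : 'I_n => e (phi b)); split=> [b|a b ab|a b ab eab||b eb].
- by rewrite /e -mem_enum mem_nth // sizeS.
- by apply: le_e => //; rewrite /phi; lia.
- have pab := e_inj _ _ (phiS a) (phiS b) eab; rewrite -[RHS]ep.
  by congr e; move: pab ab; rewrite /phi; lia.
- have ltpn : p < n by lia.
  by exists (Ordinal ltpn); rewrite -[RHS]ep /=; congr e; rewrite /phi; lia.
have phib : phi b = p by apply: e_inj => //; rewrite ep.
(* Sections of phi through b: skip the other d positions where phi waits.  The
   cap n.-1 only makes psi land in 'I_n for arguments outside [0, #|S|). *)
pose psi q := if q < p then q else if q == p then b : nat else minn (q + d) n.-1.
have psin q : psi q < n.
  have := ltn_ord b; rewrite /psi.
  by case: (ltnP q p) => ?; [lia | case: eqP => ?; lia].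
exists (fun x => Ordinal (psin (index x (enum S)))); split=> [|x Sx|x y Sx Sy /=].
- by apply: val_inj; rewrite /= -/p /psi ltnn eqxx.
- rewrite -[RHS]eK //=; congr e; move: (ltp _ Sx) phib.
  set q := index x _; rewrite /psi /phi.
  by case: (ltnP q p) => ?; [lia | case: eqP => ?; rewrite /d; lia].
- move/(idx_lt _ _ Sx Sy); move: (ltp _ Sx) (ltp _ Sy) phib (ltn_ord b).
  set q := index x _; set q' := index y _; rewrite /psi /phi.
  by case: (ltnP q p) => ?; case: (ltnP q' p) => ?; case: (q =P p) => ?;
    case: (q' =P p) => ?; rewrite /d; lia.
Qed.

(** A copy of P uses no empty column, so it meets the fibre of h over j nowhere;
    elsewhere h is injective, and the copy projects to one in M. *)
Lemma avoids_stretch (m N n k l : nat) (P : 'M[bool]_(k, l)) (M : 'M[bool]_(m, N))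
    (j : 'I_N) (h : 'I_n -> 'I_N) :
  (forall t, ~~ empty_col P t) -> empty_col M j ->
  {homo h : a b / a <= b} -> (forall a b : 'I_n, a < b -> h a = h b -> h a = j) ->
  ~~ contains M P -> ~~ contains (colsub h M) P.
Proof.
move=> hP /forallP Mj0 leh injh; apply: contra => /containsP[f [g [incf incg PM]]].
apply/containsP; exists f, (h \o g); split=> // [a b ab|i t /PM]; last by rewrite mxE.
rewrite /= ltn_neqAle leh ?andbT; last exact: ltnW (incg _ _ ab).
apply/eqP => /val_inj /(injh _ _ (incg _ _ ab)) haj.
have /forallPn[i /negPn Pia] := hP a.
by have := PM _ _ Pia; rewrite mxE haj (negPf (Mj0 _)).
Qed.

(** Lift a copy of P lying in the columns S along a section of h through b. *)
Lemma expandable_stretch (m N n k l : nat) (P : 'M[bool]_(k, l))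
    (M : 'M[bool]_(m, N)) (S : {set 'I_N}) (j : 'I_N) (i : 'I_m)
    (f : 'I_k -> 'I_m) (g : 'I_l -> 'I_N)
    (h : 'I_n -> 'I_N) (s : 'I_N -> 'I_n) (b : 'I_n) :
  {homo f : x y / x < y} -> {homo g : x y / x < y} ->
  (forall x y, P x y -> set_one M i j (f x) (g y)) -> (forall y, g y \in S) ->
  s j = b -> {in S, cancel s h} -> {in S &, {homo s : x y / x < y}} ->
  contains (set_one (colsub h M) i b) P.
Proof.
move=> incf incg PM gS sj sK incs; apply/containsP; exists f, (s \o g).
split=> // [x y /incg|x y /PM]; first exact: incs.
rewrite !set_oneE mxE /= sK //.
by case/orP => [/andP[-> /eqP->]|->]; rewrite ?orbT // sj eqxx.
Qed.

(** Since M avoids P, every copy of P created in column j meets j.  Hence one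
    copy per row costs only l - 1 columns besides the shared column j. *)
Lemma copy_columns (m N k l : nat) (P : 'M[bool]_(k, l)) (M : 'M[bool]_(m, N))
    (j : 'I_N) :
  0 < m -> ~~ contains M P -> (forall i, contains (set_one M i j) P) ->
  exists S : {set 'I_N}, [/\ j \in S, #|S| <= (l - 1) * m + 1
    & forall i, exists (f : 'I_k -> 'I_m) (g : 'I_l -> 'I_N),
      [/\ {homo f : x y / x < y}, {homo g : x y / x < y},
          forall x y, P x y -> set_one M i j (f x) (g y) & forall y, g y \in S]].
Proof.
move=> m_gt0 avM expj.
have /fin_all_exists[g copy] (i : 'I_m) : exists g : {ffun 'I_l -> 'I_N},
    exists f : 'I_k -> 'I_m, [/\ {homo f : x y / x < y}, {homo g : x y / x < y}
      & forall x y, P x y -> set_one M i j (f x) (g y)].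
  have /containsP[f [g [incf incg PM]]] := expj i.
  exists (finfun g), f.
  by split=> // [x y /incg|x y /PM]; rewrite !ffunE.
have gj i : j \in g i @: [set: 'I_l].
  apply: contraR avM => gNj; have [f [incf incg PM]] := copy i.
  apply/containsP; exists f, (g i); split=> // x y /PM.
  rewrite set_oneE; case/orP=> // /andP[_ /eqP gy].
  by case/negP: gNj; rewrite -gy imset_f.
pose S := \bigcup_i g i @: [set: 'I_l].
have Sj : j \in S by apply/bigcupP; exists (Ordinal m_gt0).
exists S; split=> // [|i]; last first.
  have [f [incf incg PM]] := copy i; exists f, (g i); split=> // y.
  by apply/bigcupP; exists i => //; apply: imset_f.
rewrite (cardsD1 j) Sj addnC leq_add2r.
have -> : S :\ j = \bigcup_i (g i @: [set: 'I_l] :\ j).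
  apply/setP => x; rewrite !inE; apply/andP/bigcupP => [[xj /bigcupP[i _ xi]]|[i _]].
    by exists i => //; rewrite !inE xj.
  by rewrite !inE => /andP[xj xi]; split=> //; apply/bigcupP; exists i.
apply: (@leq_trans (\sum_(i < m) (l - 1))); last by rewrite sum_nat_const card_ord mulnC.
have card_copy i : #|g i @: [set: 'I_l] :\ j| <= l - 1.
  have := leq_imset_card (g i) [set: 'I_l].
  by rewrite (cardsD1 j) gj cardsT card_ord; set z := #|_ :\ _|; lia.
elim/big_rec2: _ => [|i y A _ leA]; first by rewrite cards0.
by apply: leq_trans (leq_card_setU _ _) _; apply: leq_add.
Qed.

Lemma weight_le_cols (m n : nat) (M : 'M[bool]_(m, n)) (A : {set 'I_n}) :
  (forall i b, M i b -> b \in A) -> weight M <= m * #|A|.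
Proof.
move=> MA; rewrite -[in leqRHS](card_ord m) -cardsT -cardsX.
by apply: subset_leq_card; apply/subsetP => -[i b]; rewrite !inE => /MA.
Qed.

Theorem proposition3p4 (k l : nat) (hk : 0 < k) (hl : 0 < l)
    (P : 'M[bool]_(k, l)) (hP : forall j : 'I_l, ~~ empty_col P j)
    (m0 : nat) (hm0 : 0 < m0)
    (hsat : exists C N : nat, forall n : nat, N <= n -> sat m0 n P <= C) :
  (exists (r c : nat) (W : 'M[bool]_(r, c)),
      [/\ 0 < r, c <= (l - 1) * m0 + 1 & horizontal_witness P W]) /\
  (forall n : nat, 0 < n -> sat m0 n P <= (l - 1) * m0 ^ 2).
Proof.
have P_nz : exists i j, P i j.
  by have /forallPn[i /negPn Pi] := hP (Ordinal hl); exists i, (Ordinal hl).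
have [C [N0 satC]] := hsat.
pose N := maxn N0 C.+1.
have [[M /andP[avM /forallP satM] wM] _] := satP m0 N P_nz.
have [|j Mj0] := @exists_empty_col _ _ M.
  by rewrite wM (leq_ltn_trans (satC _ (leq_maxl _ _))) // leq_max ltnSn orbT.
have expj i : contains (set_one M i j) P.
  have /forallP/(_ j)/implyP := satM i; apply.
  by move/forallP: Mj0.
have [S [Sj cardS copies]] := copy_columns hm0 avM expj.
have stretched n : #|S| <= n -> exists h : 'I_n -> 'I_N,
    [/\ ~~ contains (colsub h M) P, exists b, h b = j,
        forall b, h b = j -> expandable P (colsub h M) b
      & #|[set b | h b != j]| <= #|S|.-1].
  move=> leSn; have [h [hS leh injh hj sec]] := stretch_columns Sj leSn.
  exists h; split=> // [|b hb|]; first exact: avoids_stretch leh injh avM.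
  - apply/andP; split; apply/forallP => i; first by rewrite mxE hb (forallP Mj0).
    have [f [g [incf incg PM gS]]] := copies i; have [s [sj sK incs]] := sec b hb.
    exact: expandable_stretch incf incg PM gS sj sK incs.
  rewrite (cardsD1 j S) Sj -(card_in_imset (f := h)).
    apply: subset_leq_card; apply/subsetP => _ /imsetP[b hb ->].
    by move: hb; rewrite !inE hS andbT.
  move=> a b; rewrite !inE => haj hbj hab; apply: val_inj.
  case: (ltngtP a b) => // lt_ab; [case/eqP: haj | case/eqP: hbj].
    exact: injh hab.
  exact: injh lt_ab (esym hab).
split.
  have [h [avW [b hb] expW _]] := stretched _ (leqnn _).
  exists m0, #|S|, (colsub h M); split=> //.
  by apply/andP; split=> //; apply/existsP; exists b; apply: expW.
move=> n n_gt0; have [[_ _ _] sat_le] := satP m0 n P_nz.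
have -> : (l - 1) * m0 ^ 2 = m0 * ((l - 1) * m0) by rewrite mulnCA mulnn.
have [leSn|lt_nS] := leqP #|S| n; last first.
  have [M' /sat_le le_w] := saturated_exists m0 n P_nz.
  apply: leq_trans le_w (leq_trans (weight_le _) _).
  by have := leq_trans lt_nS cardS; rewrite addn1 ltnS leq_mul2l => ->; rewrite orbT.
have [h [avW _ expW cardh]] := stretched _ leSn.
have [M' satM' leWM'] := saturated_above avW.
apply: leq_trans (sat_le _ satM') _.
apply: (@leq_trans (m0 * #|[set b | h b != j]|)); last first.
  rewrite leq_mul2l (leq_trans cardh) ?orbT //.
  by move: cardS; rewrite addn1; case: #|S|.
apply: weight_le_cols => i b M'ib; rewrite inE.
(* A one of M' in a copy of j would put set_one (colsub h M) i b below M'. *)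
apply/negP => /eqP hb; have /andP[_ /forallP/(_ i) Wib] := expW _ hb.
have /andP[/negP avM' _] := satM'; apply: avM'; apply: contains_mono Wib => x y.
by rewrite set_oneE => /orP[/andP[/eqP-> /eqP->]|/leWM'].
Qed.
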